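(* Let $b\geq 2$ be an integer. For any nonnegative integers $n$ and $m$, \[ S_b(m+n)\geq S_b(m)+S_b(n)+\min\{m,n\}. \]
   Context: For an integer $b\geq 2$ and $n\in\mathbb{Z}_{\ge 0}$, $s_b(n)$ denotes the sum of the digits of $n$ in base $b$, and $S_b(N)=\sum_{n=0}^{N-1}s_b(n)$ for $N\in\mathbb{Z}_{\ge0}$ (so $S_b(0)=0$). *)

(* Defs.v *)
From mathcomp Require Import all_boot.

Set Implicit Arguments.
Unset Strict Implicit.
Unset Printing Implicit Defensive.

(* Coefficient of b ^ i in the base-b expansion of n (meaningful for 1 < b). *)
Definition digit (b n i : nat) : nat := (n %/ b ^ i) %% b.

(* For 1 < b and 0 < n the leading digit of n is at position trunc_log b n;
   trunc_log b 0 = 0, so that 0 has the single digit 0. *)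
Definition digit_sum (b n : nat) : nat :=
  \sum_(i < (trunc_log b n).+1) digit b n i.

Definition cumulative_digit_sum (b N : nat) : nat :=
  \sum_(n < N) digit_sum b n.

Lemma ltn_digit b n i : 1 < b -> digit b n i < b.
Proof. by move=> b_gt1; rewrite ltn_mod ltnW. Qed.

Lemma digit_expansion b n : 1 < b ->
  n = \sum_(i < (trunc_log b n).+1) digit b n i * b ^ i.
Proof.
move=> b_gt1.
have modE k : n %% b ^ k = \sum_(i < k) digit b n i * b ^ i.
  elim: k => [|k IHk]; first by rewrite big_ord0 modn1.
  rewrite big_ord_recr /= -IHk /digit.
  rewrite modn_divl -expnS {1}(divn_eq (n %% b ^ k.+1) (b ^ k)).
  by rewrite modn_dvdm ?dvdn_exp2l // addnC.
by rewrite -modE modn_small // trunc_log_ltn.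
Qed.

(* Main.v *)
Require Import Defs.
From mathcomp Require Import all_boot.
From mathcomp Require Import zify.

(** Write [m = b q + r] and [n = b p + t]. The partial sum [S (b q + r)] is the
    combination [(b - r) S q + r S (q + 1)] plus a term linear in [q] plus
    [binomial (r, 2)]. Pairing the [b] terms [S q], [S (q + 1)] of [m] with the
    [b] terms [S p], [S (p + 1)] of [n] so that the sum of the arguments takes
    only two consecutive values reproduces the corresponding formula for
    [m + n]. Strong induction applies to each pair, and the binomial terms leave
    a surplus [r t] without carry, or [(b - r) (b - t)] with carry, which makes
    up for the loss in the minimum when [q = p]. *)

Lemma sum_digit_eq b n k l : n < b ^ k -> n < b ^ l ->
  \sum_(i < k) digit b n i = \sum_(i < l) digit b n i.
Proof.
wlog le_kl : k l / k <= l => [hw nk nl | lt_nk _].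
  by case: (leqP k l) => [|/ltnW] le; [exact: hw | rewrite (hw l k)].
rewrite -(subnKC le_kl) big_split_ord /= [X in _ = _ + X]big1 ?addn0 // => i _.
by rewrite /digit expnD divnMA (divn_small lt_nk) div0n mod0n.
Qed.

Lemma digit_sum_mulD b q r : 1 < b -> r < b ->
  digit_sum b (b * q + r) = digit_sum b q + r.
Proof.
move=> b_gt1 lt_rb; have b_gt0 := ltnW b_gt1.
set N := b * q + r.
have divN : N %/ b = q by rewrite /N mulnC divnMDl // divn_small // addn0.
have modN : N %% b = r by rewrite /N mulnC modnMDl modn_small.
(* [N] gets one digit position more than [q], so that splitting off the units digit leaves two sums
   over the same range. *)
have ltN : N < b ^ N.+1 by apply: ltn_trans (ltnSn N) (ltn_expl _ b_gt1).
have ltq : q < b ^ N.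
  by apply: leq_ltn_trans (ltn_expl _ b_gt1); rewrite /N; nia.
rewrite /digit_sum (sum_digit_eq _ _ _ N.+1 (trunc_log_ltn _ b_gt1) ltN).
rewrite (sum_digit_eq _ _ _ N (trunc_log_ltn _ b_gt1) ltq).
rewrite big_ord_recl addnC; congr (_ + _).
  by apply: eq_bigr => i _; rewrite /digit /= /bump /= add1n expnS divnMA divN.
by rewrite /digit expn0 divn1 modN.
Qed.

Lemma cumulative_digit_sumS b n :
  cumulative_digit_sum b n.+1 = cumulative_digit_sum b n + digit_sum b n.
Proof. by rewrite /cumulative_digit_sum big_ord_recr. Qed.

Lemma cumulative_digit_sum0 b : cumulative_digit_sum b 0 = 0.
Proof. by rewrite /cumulative_digit_sum big_ord0. Qed.

Lemma cumulative_digit_sum_block b q r : 1 < b -> r <= b ->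
  cumulative_digit_sum b (b * q + r) =
  cumulative_digit_sum b (b * q) + r * digit_sum b q + 'C(r, 2).
Proof.
move=> b_gt1; elim: r => [|r IHr] lt_rb; first by rewrite !addn0.
rewrite addnS cumulative_digit_sumS IHr 1?ltnW // digit_sum_mulD // binS bin1.
lia.
Qed.

Lemma cumulative_digit_sum_mul b q : 1 < b ->
  cumulative_digit_sum b (b * q) = b * cumulative_digit_sum b q + q * 'C(b, 2).
Proof.
move=> b_gt1; elim: q => [|q IHq].
  by rewrite muln0 cumulative_digit_sum0 muln0.
rewrite mulnS addnC cumulative_digit_sum_block // IHq cumulative_digit_sumS.
lia.
Qed.

(** The [r] copies of [digit_sum b q] turn [r] of the [b] sums up to [q] into sums up to [q.+1].
    Here [x] is [b - r], free of truncated subtraction. *)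
Lemma cumulative_digit_sum_interpolate b q r x : 1 < b -> x + r = b ->
  cumulative_digit_sum b (b * q + r) =
  x * cumulative_digit_sum b q + r * cumulative_digit_sum b q.+1
    + q * 'C(b, 2) + 'C(r, 2).
Proof.
move=> b_gt1 def_b; rewrite cumulative_digit_sum_block //; last lia.
rewrite cumulative_digit_sum_mul // cumulative_digit_sumS.
have := mulnDl x r (cumulative_digit_sum b q); rewrite def_b.
lia.
Qed.

Lemma bin2D r t : 'C(r + t, 2) = 'C(r, 2) + 'C(t, 2) + r * t.
Proof.
elim: t => [|t IHt]; first by rewrite muln0 bin0n !addn0.
by rewrite addnS !binS !bin1 IHt; lia.
Qed.

Lemma minn_leq_mul r t : minn r t <= r * t.
Proof.
case: t => [|t]; first by rewrite minn0.
exact: leq_trans (geq_minl _ _) (leq_pmulr _ _).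
Qed.

(** For [q] and [p] distinct, the minima on the right all pick the same side and add up to one
    argument on the left. For [q = p] the mixed minima fall short by [minn r t], which [r * t]
    covers. *)
Lemma minn_split_nocarry q p x r t :
  minn ((x + (r + t)) * q + r) ((x + (r + t)) * p + t) <=
  x * minn q p + r * minn q.+1 p + t * minn q p.+1 + r * t.
Proof.
case: (ltngtP q p) => [lt_qp|lt_pq|->].
- apply: leq_trans (geq_minl _ _) _.
  have -> : minn q.+1 p = q.+1 by lia.
  have -> : minn q p.+1 = q by lia.
  lia.
- apply: leq_trans (geq_minr _ _) _.
  have -> : minn q.+1 p = p by lia.
  have -> : minn q p.+1 = p.+1 by lia.
  lia.
- have -> : minn p.+1 p = p by lia.
  have -> : minn p p.+1 = p by lia.
  have := minn_leq_mul r t; rewrite -addn_minr; lia.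
Qed.

(** Meant for [x = b - r], [y = b - t], [z = r + t - b]; at [q = p] the shortfall is [minn x y]. *)
Lemma minn_split_carry q p x y z :
  minn ((x + y + z) * q + (y + z)) ((x + y + z) * p + (x + z)) <=
  z * minn q.+1 p.+1 + y * minn q.+1 p + x * minn q p.+1 + x * y.
Proof.
rewrite minnSS; case: (ltngtP q p) => [lt_qp|lt_pq|->].
- apply: leq_trans (geq_minl _ _) _.
  have -> : minn q.+1 p = q.+1 by lia.
  have -> : minn q p.+1 = q by lia.
  lia.
- apply: leq_trans (geq_minr _ _) _.
  have -> : minn q.+1 p = p by lia.
  have -> : minn q p.+1 = p.+1 by lia.
  lia.
- have -> : minn p.+1 p = p by lia.
  have -> : minn p p.+1 = p by lia.
  have := minn_leq_mul x y; rewrite -addn_minr; lia.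
Qed.

Theorem theorem1 (b m n : nat) (hb : 2 <= b) :
  cumulative_digit_sum b m + cumulative_digit_sum b n + minn m n
    <= cumulative_digit_sum b (m + n).
Proof.
have [N leN] := ubnP (m + n); elim: N m n leN => // N IHN m n leN.
have [->|m_gt0] := posnP m.
  by rewrite cumulative_digit_sum0 min0n add0n addn0.
have [->|n_gt0] := posnP n.
  by rewrite cumulative_digit_sum0 minn0 !addn0.
(* Weight 0 must be exempt: for [b = 2] and [m = n = 1] the carry pair [(q.+1, p.+1)] is [(m, n)]
   itself, with weight [z = 0]. *)
have IHk k i j : (0 < k -> i + j < m + n) ->
  k * cumulative_digit_sum b i + k * cumulative_digit_sum b j + k * minn i j
    <= k * cumulative_digit_sum b (i + j).
  case: k => // k /(_ isT) lt_ij; rewrite -!mulnDr leq_mul2l IHN ?orbT //.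
  exact: leq_trans lt_ij leN.
have b_gt0 := ltnW hb.
have := ltn_pmod m b_gt0; have := ltn_pmod n b_gt0.
move: (divn_eq m b) (divn_eq n b).
move: (m %/ b) (m %% b) (n %/ b) (n %% b) => q r p t.
rewrite ![_ * b]mulnC => def_m def_n lt_tb lt_rb.
have [lt_rt|le_rt] := ltnP (r + t) b.
- have [x def_b] : {x | x + (r + t) = b} by exists (b - (r + t)); lia.
  have def_mn : m + n = b * (q + p) + (r + t) by lia.
  (* The weights match: [q.+1] occurs [r] times, [p.+1] occurs [t] times, and the sum [(q + p).+1]
     occurs [r + t] times. *)
  have IH1 := IHk x q p ltac:(nia).
  have IH2 := IHk r q.+1 p ltac:(nia).
  have IH3 := IHk t q p.+1 ltac:(nia).
  rewrite {}def_mn (cumulative_digit_sum_interpolate _ _ _ x) // bin2D.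
  rewrite def_m (cumulative_digit_sum_interpolate _ _ _ (x + t)) //; last lia.
  rewrite def_n (cumulative_digit_sum_interpolate _ _ _ (x + r)) //; last lia.
  rewrite ?addSn ?addnS in IH1 IH2 IH3.
  have := minn_split_nocarry q p x r t; rewrite def_b.
  lia.
- have [z def_z] : {z | z + b = r + t} by exists (r + t - b); lia.
  have [x def_x] : {x | x + r = b} by exists (b - r); lia.
  have [y def_y] : {y | y + t = b} by exists (b - t); lia.
  have def_mn : m + n = b * (q + p).+1 + z by lia.
  (* Now [q.+1] occurs [z + y = r] times and [p.+1] occurs [z + x = t] times; the sums are
     [(q + p).+2], [z] times, and [(q + p).+1], [x + y] times. *)
  have IH1 := IHk z q.+1 p.+1 ltac:(nia).
  have IH2 := IHk y q.+1 p ltac:(nia).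
  have IH3 := IHk x q p.+1 ltac:(nia).
  rewrite {}def_mn (cumulative_digit_sum_interpolate _ _ _ (x + y)) //; last lia.
  rewrite def_m (cumulative_digit_sum_interpolate _ _ _ x) //.
  rewrite def_n (cumulative_digit_sum_interpolate _ _ _ y) //.
  rewrite ?addSn ?addnS in IH1 IH2 IH3.
  have def_r : r = y + z by lia.
  have def_t : t = x + z by lia.
  (* The carry raises the quotient to [(q + p).+1], which gives one extra ['C(b, 2)]; this is where
     the surplus [x * y] comes from. *)
  have binE : 'C(b, 2) + 'C(z, 2) = 'C(r, 2) + 'C(t, 2) + x * y.
    by rewrite -def_x def_t def_r !bin2D; lia.
  have := minn_split_carry q p x y z.
  rewrite -def_r -def_t (_ : x + y + z = b); last lia.
  have linE : (q + p).+1 * 'C(b, 2) = q * 'C(b, 2) + p * 'C(b, 2) + 'C(b, 2) by lia.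
  lia.
Qed.
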